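(* Let $1\le k\le n$. Let $S_1$ and $S_2$ be two $k$-out-of-$n$ systems with one cold standby unit each, with lifetimes $T_1$ and $T_2$; let $X_1,\ldots,X_n$ and $Y_1,\ldots,Y_n$ be the lifetimes of the active components of $S_1$ and $S_2$, respectively, and let $Z_i$ be the lifetime of the standby unit of $S_i$, $i=1,2$ (arbitrary distributions allowed). If $X_1,\ldots,X_n,Z_1$ are independent, $Y_1,\ldots,Y_n,Z_2$ are independent, $X_i\le_{st}Y_i$ for $i=1,\ldots,n$, and $Z_1\le_{st}Z_2$, then $$T_1\le_{st}T_2\quad\text{and, in consequence,}\quad E\,T_1\le E\,T_2.$$
   Context: Lifetimes are non-negative random variables; expectations are taken in $[0,\infty]$. For $W_1,\ldots,W_n$ let $W_{1:n}\le\cdots\le W_{n:n}$ be the order statistics and $W_{n+1:n}:=\infty$. The system lifetimes are $T_1=\min(X_{n-k+1:n}+Z_1,\,X_{n-k+2:n})$ and $T_2=\min(Y_{n-k+1:n}+Z_2,\,Y_{n-k+2:n})$. Usual stochastic order: $X\le_{st}Y$ means $P(X>s)\le P(Y>s)$ for all $s$. *)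

(* Defs.v *)
From HB Require Import structures.
From mathcomp Require Import all_boot all_order all_algebra.
From mathcomp Require Import all_classical all_reals all_analysis.

Set Implicit Arguments.
Unset Strict Implicit.
Unset Printing Implicit Defensive.

Import Order.TTheory GRing.Theory Num.Theory.
Import numFieldNormedType.Exports.

Local Open Scope classical_set_scope.
Local Open Scope ring_scope.
Local Open Scope ereal_scope.

(* Mutual independence of a finite family of real random variables: the
   product rule for every subfamily. *)
Definition mutually_independent (d : measure_display) (T : measurableType d)
    (R : realType) (P : probability T R) (I : finType)
    (X : I -> {RV P >-> R}) : Prop :=
  forall (J : {set I}) (B : I -> set R),
    (forall i, measurable (B i)) ->
    P (\bigcap_(i in [set` J]) (X i @^-1` B i)) =
    \prod_(i in J) P (X i @^-1` B i).

Definition with_standby (d : measure_display) (T : measurableType d)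
    (R : realType) (P : probability T R) (n : nat)
    (X : 'I_n -> {RV P >-> R}) (Z : {RV P >-> R}) :
    option 'I_n -> {RV P >-> R} :=
  fun o => if o is Some i then X i else Z.

(* The two variables may live on different probability spaces. *)
Definition st_le (R : realType)
    (d1 : measure_display) (T1 : measurableType d1) (P1 : probability T1 R)
    (d2 : measure_display) (T2 : measurableType d2) (P2 : probability T2 R)
    (U : T1 -> \bar R) (V : T2 -> \bar R) : Prop :=
  forall s : R, P1 [set w | s%:E < U w] <= P2 [set w | s%:E < V w].

(* W_{j:n} at the outcome w, for 1 <= j (1-based index); the default value of
   nth gives W_{n+1:n} = +oo. *)
Definition order_stat (R : realType) (T : Type) (n : nat)
    (W : 'I_n -> T -> R) (j : nat) (w : T) : \bar R :=
  nth +oo (sort <=%O [seq (W i w)%:E | i <- enum 'I_n]) j.-1.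

Definition standby_lifetime (R : realType) (T : Type) (n k : nat)
    (W : 'I_n -> T -> R) (Z : T -> R) (w : T) : \bar R :=
  Order.min (order_stat W (n - k + 1) w + (Z w)%:E)
            (order_stat W (n - k + 2) w).

(* Main.v *)
(* Up to a countable increasing union, the event [T > s] only depends on which
   of finitely many thresholds each lifetime exceeds, and it is increasing in
   each lifetime.  After discretization the lifetimes are independent, finitely
   valued and stochastically ordered, and replacing them one by one can only
   increase the probability of an upper set: conditionally on the other
   coordinates such a set is a tail event.  The expectations are then compared
   through the formula [E T = int_0^oo P (T > s) ds]. *)

Require Import Defs.
From HB Require Import structures.
From mathcomp Require Import all_boot all_order all_algebra.
From mathcomp Require Import all_classical all_reals all_analysis.

Set Implicit Arguments.
Unset Strict Implicit.
Unset Printing Implicit Defensive.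

Import Order.TTheory GRing.Theory Num.Theory.
Import numFieldNormedType.Exports.

Local Open Scope classical_set_scope.
Local Open Scope ring_scope.

(** * Upper sets under product weights on finite chains *)

Lemma ler_sum_upset (R : numDomainType) (M : nat) (p q : 'I_M -> R)
    (u : pred 'I_M) :
  (forall c, \sum_(b < M | (c <= b)%N) p b <= \sum_(b < M | (c <= b)%N) q b) ->
  (forall b c : 'I_M, (b <= c)%N -> u b -> u c) ->
  \sum_(b | u b) p b <= \sum_(b | u b) q b.
Proof.
move=> pq u_up; have [|[b ub]] := set_0Vmem [set b | u b].
  move=> /setP u0; have {}u0 b : u b = false by have := u0 b; rewrite !inE.
  by rewrite !big_pred0.
have {}ub : u b by move: ub; rewrite inE.
(* A nonempty upper set of a chain is the tail above its least element [c], so [pq] at [c] is the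
   claim. *)
case: (arg_minnP (fun b : 'I_M => b : nat) ub) => c uc cmin.
have uE x : u x = (c <= x)%N.
  by apply/idP/idP => [/cmin//|cx]; exact: u_up cx uc.
by rewrite !(eq_bigl _ _ uE).
Qed.

Definition ffun_set (I : finType) (A : Type) (f : {ffun I -> A}) (a : I)
  (c : A) : {ffun I -> A} := [ffun i => if i == a then c else f i].

(** With the coordinates other than [a] frozen, their weights form a common nonnegative factor, and
    the section of [u] along [a] is an upper set of a chain. *)
Lemma ler_sum_prod_upset1 (R : numDomainType) (I : finType) (M : nat) (a : I)
    (p q : I -> 'I_M.+1 -> R) (u : pred {ffun I -> 'I_M.+1}) :
  (forall i c, 0 <= p i c) ->
  (forall i c, i != a -> q i c = p i c) ->
  (forall c, \sum_(b < M.+1 | (c <= b)%N) p a b <=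
             \sum_(b < M.+1 | (c <= b)%N) q a b) ->
  (forall f g : {ffun I -> 'I_M.+1},
    (forall i, f i <= g i)%N -> u f -> u g) ->
  \sum_(f | u f) \prod_i p i (f i) <= \sum_(f | u f) \prod_i q i (f i).
Proof.
move=> p0 qp pq u_up.
(* Resetting coordinate [a] to [ord0] labels the line through [f] in direction [a]; both sums are
   split along these lines. *)
pose base f := @ffun_set I 'I_M.+1 f a ord0.
rewrite (partition_big base predT)//= [leRHS](partition_big base predT)//=.
apply: ler_sum => g _.
(* A line is parametrized by its value [c] at [a]. The condition [base g == g], constant in [c],
   discards the [g] that label no line. *)
have reix (F : {ffun I -> 'I_M.+1} -> R) : \sum_(f | u f && (base f == g)) F f =
    \sum_(c | u (ffun_set g a c) && (base g == g)) F (ffun_set g a c).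
  rewrite (@reindex_onto _ _ _ _ _ (ffun_set g a) (fun f => f a)).
    apply: eq_bigl => c; have -> : ffun_set g a c a = c by rewrite ffunE eqxx.
    have -> : base (ffun_set g a c) = base g.
      by apply/ffunP => i; rewrite !ffunE; case: (i == a).
    by rewrite eqxx andbT.
  move=> f /andP[_ /eqP <-]; apply/ffunP => i; rewrite !ffunE.
  by case: eqP => [->|].
have prodE (r : I -> 'I_M.+1 -> R) c : (forall i c, i != a -> r i c = p i c) ->
    \prod_i r i (ffun_set g a c i) = r a c * \prod_(i | i != a) p i (g i).
  move=> rp; rewrite (bigD1 a)//= ffunE eqxx; congr (_ * _).
  by apply: eq_bigr => i ia; rewrite ffunE (negPf ia) rp.
rewrite !reix (eq_bigr _ (fun c _ => prodE p c (fun _ _ _ => erefl))).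
rewrite (eq_bigr _ (fun c _ => prodE q c qp)) -!mulr_suml.
apply: ler_wpM2r; first exact: prodr_ge0.
apply: ler_sum_upset => // b c bc /andP[ub ->]; rewrite andbT.
by apply: u_up ub => i; rewrite !ffunE; case: ifP.
Qed.

(* The coordinates of [p] are replaced by those of [q] one at a time. *)
Lemma ler_sum_prod_upset (R : numDomainType) (I : finType) (M : nat)
    (p q : I -> 'I_M.+1 -> R) (u : pred {ffun I -> 'I_M.+1}) :
  (forall i c, 0 <= p i c) -> (forall i c, 0 <= q i c) ->
  (forall i c, \sum_(b < M.+1 | (c <= b)%N) p i b <=
               \sum_(b < M.+1 | (c <= b)%N) q i b) ->
  (forall f g : {ffun I -> 'I_M.+1},
    (forall i, f i <= g i)%N -> u f -> u g) ->
  \sum_(f | u f) \prod_i p i (f i) <= \sum_(f | u f) \prod_i q i (f i).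
Proof.
move=> p0 q0 pq u_up.
pose h (s : seq I) i := if i \in s then q i else p i.
suff hP s : uniq s ->
    \sum_(f | u f) \prod_i p i (f i) <= \sum_(f | u f) \prod_i h s i (f i).
  apply: le_trans (hP _ (enum_uniq I)) _.
  rewrite le_eqVlt; apply/orP; left; apply/eqP.
  by apply: eq_bigr => f _; apply: eq_bigr => i _; rewrite /h mem_enum.
elim: s => [_|a s IH /= /andP[nas /IH /le_trans]]; first exact: lexx.
apply; apply: (@ler_sum_prod_upset1 _ _ _ a) => //.
- by move=> i c; rewrite /h; case: ifP.
- by move=> i c ia; rewrite /h inE (negPf ia).
- by move=> c; rewrite /h inE eqxx (negPf nas).
Qed.

(** * Discretization of the real line by finitely many thresholds *)

Definition level (R : realType) (ts : seq R) (x : R) : nat := count (< x) ts.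

(** Exceeding at least [c.+1] thresholds means exceeding the one of 0-based rank [c] in sorted
    order. Tails of levels are thus open rays, the sets on which [st_le] gives information, or
    trivial. *)
Lemma level_tail (R : realType) (ts : seq R) (c : nat) :
  let A := [set x | (c <= level ts x)%N] in
  [\/ A = setT, A = set0 | exists t, A = `]t, +oo[%classic].
Proof.
move=> A; case: c @A => [|c] A; first by constructor 1; apply/seteqP; split.
have [cs|sc] := ltnP c (size ts); last first.
  constructor 2; apply/seteqP; split => // x; rewrite /A /=.
  by rewrite ltnNge (leq_trans (count_size _ _) sc).
constructor 3; exists (nth 0 (sort <=%O ts) c).
apply/seteqP; split => x; rewrite /A /=.
  rewrite in_itv/= andbT /level -(count_sort <=%O) => cx.
  exact: (nth_count_lt _ (sort_le_sorted _)).
rewrite in_itv/= andbT => tx; rewrite ltnNge; apply/negP => xc.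
move: tx; rewrite ltNge nth_count_ge ?sort_le_sorted// size_sort cs andbT.
by rewrite count_sort.
Qed.

(** The thresholds below [x] and those below [y] are nested, so their counts decide the inclusion:
    if [y <= t < x], those below [y] are among those below [x] and miss [t], so they are strictly
    fewer. *)
Lemma level_le (R : realType) (ts : seq R) (x y : R) :
  (level ts x <= level ts y)%N -> forall t, t \in ts -> t < x -> t < y.
Proof.
move=> xy t tts tx; rewrite ltNge; apply/negP => yt; move: xy.
rewrite leqNgt => /negP; apply; rewrite /level -!size_filter.
have -> : [seq z <- ts | z < y] = [seq z <- [seq z <- ts | z < x] | z < y].
  rewrite -filter_predI; apply: eq_filter => z /=; apply/idP/andP => [zy|[]//].
  by rewrite zy (lt_trans zy (le_lt_trans yt tx)).
rewrite size_filter ltn_neqAle count_size andbT -all_count.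
apply/negP => /allP/(_ t); rewrite mem_filter tx tts => /(_ isT).
by rewrite ltNge yt.
Qed.

Lemma probability_fin_preimage (d : measure_display) (T : measurableType d)
    (R : realType) (P : probability T R) (F : finType) (g : T -> F)
    (A : pred F) :
  (forall f, measurable (g @^-1` [set f])) ->
  P [set w | A (g w)] = (\sum_(f | A f) P (g @^-1` [set f]))%E /\
  measurable [set w | A (g w)].
Proof.
move=> mg; rewrite -[in X in _ = X]big_enum/=.
have -> : [set w | A (g w)] = [set w | g w \in enum A].
  by apply/seteqP; split => w /=; rewrite mem_enum.
elim: (enum A) (enum_uniq A) => [_|f s IH /= /andP[fs /IH[Ps ms]]].
  have -> : [set w | g w \in [::]] = set0 by apply/seteqP; split.
  by rewrite big_nil measure0; split.
have -> : [set w | g w \in f :: s] = g @^-1` [set f] `|` [set w | g w \in s].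
  apply/seteqP; split => w /=; rewrite inE.
    by case/orP => [/eqP|]; [left|right].
  by case=> [->|->]; rewrite ?eqxx ?orbT.
split; last exact: measurableU.
rewrite big_cons measureU//; first by congr (_ + _)%E.
by apply/seteqP; split => // w /= [->]; rewrite (negPf fs).
Qed.

Lemma measurable_level_tail (R : realType) (ts : seq R) (c : nat) :
  measurable [set x | (c <= level ts x)%N].
Proof.
have [-> | -> | [t ->]] := level_tail ts c.
- exact: measurableT.
- exact: measurable0.
- exact: measurable_itv.
Qed.

Lemma measurable_level (R : realType) (ts : seq R) (c : nat) :
  measurable [set x | level ts x = c].
Proof.
have -> : [set x | level ts x = c] = [set x | (c <= level ts x)%N] `\`
    [set x | (c.+1 <= level ts x)%N].
  apply/seteqP; split => x /=; first by move=> ->; rewrite ltnn leqnn.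
  by case=> cx /negP; rewrite -leqNgt => xc; apply/eqP; rewrite eqn_leq cx xc.
by apply: measurableD; exact: measurable_level_tail.
Qed.

(** * Probabilities of monotone threshold events *)

Section threshold_events.
Context (d : measure_display) (T : measurableType d) (R : realType)
  (P : probability T R) (I : finType) (X : I -> {RV P >-> R}) (ts : seq R).

Let lev (x : R) : 'I_(size ts).+1 := inord (level ts x).

Let levE x : lev x = level ts x :> nat.
Proof. by rewrite inordK// ltnS count_size. Qed.

Definition level_pmf (i : I) (c : 'I_(size ts).+1) : R :=
  fine (P (X i @^-1` [set x | level ts x = c])).

Lemma level_pmf_ge0 i c : 0 <= level_pmf i c.
Proof. exact: fine_ge0. Qed.

Let measurable_lev i c : measurable ((lev \o X i) @^-1` [set c]).
Proof.
have -> : (lev \o X i) @^-1` [set c] = X i @^-1` [set x | level ts x = c].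
  apply/seteqP; split => w /=; first by move=> <-; rewrite levE.
  by move=> wc; apply/val_inj; rewrite /= levE.
by apply: measurable_funPTI => //; exact: measurable_level.
Qed.

Let pmfE i c : (level_pmf i c)%:E = P ((lev \o X i) @^-1` [set c]).
Proof.
rewrite /level_pmf fineK; last first.
  apply: fin_num_measure; apply: measurable_funPTI => //.
  exact: measurable_level.
congr (P _); apply/seteqP; split => w /=; last by move=> <-; rewrite levE.
by move=> wc; apply/val_inj; rewrite /= levE.
Qed.

Lemma level_pmf_tail i (c : nat) :
  (\sum_(b < (size ts).+1 | (c <= b)%N) level_pmf i b)%:E =
  P [set w | (c <= level ts (X i w))%N].
Proof.
rewrite -sumEFin (eq_bigr _ (fun b _ => pmfE i b)).
rewrite -(probability_fin_preimage P (fun b : 'I__ => (c <= b)%N)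
  (measurable_lev i)).1.
by congr (P _); apply/seteqP; split => w /=; rewrite levE.
Qed.

Let levX w : {ffun I -> 'I_(size ts).+1} := [ffun i => lev (X i w)].

Let levXE f : levX @^-1` [set f] =
  \bigcap_(i in [set` [set: I]%SET]) (X i @^-1` [set x | level ts x = f i]).
Proof.
apply/seteqP; split => w /=; first by move=> <- i _ /=; rewrite ffunE levE.
move=> wf; apply/ffunP => i; apply/val_inj; rewrite /= ffunE levE.
by apply: wf => /=; rewrite inE.
Qed.

Let measurable_levX f : measurable (levX @^-1` [set f]).
Proof.
rewrite levXE; apply: fin_bigcap_measurable; first exact: finite_finset.
by move=> i _; apply: measurable_funPTI => //; exact: measurable_level.
Qed.

Hypothesis indep : mutually_independent X.

(** Independence enters here, for the full index set and the level cells: the joint law of the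
    levels is a product. *)
Let levX_prob f : P (levX @^-1` [set f]) = (\prod_i level_pmf i (f i))%:E.
Proof.
rewrite levXE indep; last by move=> i; exact: measurable_level.
rewrite -prodEFin; apply: eq_big => [i|i _]; first by rewrite inE.
rewrite fineK// fin_num_measure//; apply: measurable_funPTI => //.
exact: measurable_level.
Qed.

Variable E : (I -> R) -> Prop.
Hypothesis E_up : forall u v,
  (forall i t, t \in ts -> t < u i -> t < v i) -> E u -> E v.

(* [E] only depends on the levels of its argument. *)
Definition level_event : pred {ffun I -> 'I_(size ts).+1} :=
  fun f => `[< exists2 v, E v & forall i, (level ts (v i) <= f i)%N >].

(** The existential in [level_event] yields monotonicity on the whole grid, including levels that no
    real number attains when thresholds repeat. *)
Lemma level_event_up (f g : {ffun I -> 'I_(size ts).+1}) :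
  (forall i, f i <= g i)%N -> level_event f -> level_event g.
Proof.
move=> fg /asboolP[v Ev vf]; apply/asboolP; exists v => // i.
exact: leq_trans (vf i) (fg i).
Qed.

Let level_eventE :
  [set w | E (fun i => X i w)] = [set w | level_event (levX w)].
Proof.
apply/seteqP; split => w /=.
  by move=> Ew; apply/asboolP; exists (X^~ w) => // i; rewrite ffunE levE.
(* The witness [v] has levels at most those of [X] at [w], hence exceeds no further threshold, and
   [E_up] carries [E] over. *)
move=> /asboolP[v Ev vw]; apply: E_up Ev => i.
by apply: level_le; rewrite (leq_trans (vw i))// ffunE levE.
Qed.

Lemma measurable_threshold_event : measurable [set w | E (fun i => X i w)].
Proof.
by rewrite level_eventE; exact: (probability_fin_preimage P _ measurable_levX).2.
Qed.

Lemma threshold_event_prob :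
  P [set w | E (fun i => X i w)] =
  (\sum_(f | level_event f) \prod_i level_pmf i (f i))%:E.
Proof.
rewrite level_eventE (probability_fin_preimage P _ measurable_levX).1.
by rewrite (eq_bigr _ (fun f _ => levX_prob f)) sumEFin.
Qed.

End threshold_events.

(** [level_event] depends on [ts] and [E] alone, so both probabilities sum product weights over the
    same upper set. The tails of the marginal weights are ordered because each tail event is sure,
    impossible, or a ray covered by [st_le]. *)
Lemma threshold_event_st_le (R : realType)
    (d1 : measure_display) (T1 : measurableType d1) (P1 : probability T1 R)
    (d2 : measure_display) (T2 : measurableType d2) (P2 : probability T2 R)
    (I : finType) (X : I -> {RV P1 >-> R}) (Y : I -> {RV P2 >-> R})
    (ts : seq R) (E : (I -> R) -> Prop) :
  mutually_independent X -> mutually_independent Y ->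
  (forall i, st_le P1 P2 (EFin \o X i) (EFin \o Y i)) ->
  (forall u v, (forall i t, t \in ts -> t < u i -> t < v i) -> E u -> E v) ->
  (P1 [set w | E (fun i => X i w)] <= P2 [set w | E (fun i => Y i w)])%E.
Proof.
move=> iX iY XY E_up.
rewrite !(threshold_event_prob _ E_up)// lee_fin.
apply: ler_sum_prod_upset; [exact: level_pmf_ge0..| |exact: level_event_up].
move=> i c; rewrite -lee_fin !level_pmf_tail.
have [tl|tl|[t tl]] := level_tail ts c.
- rewrite (_ : [set _ | _] = X i @^-1` setT); last by rewrite -tl.
  rewrite (_ : [set _ | _] = Y i @^-1` setT); last by rewrite -tl.
  by rewrite !preimage_setT !probability_setT.
- rewrite (_ : [set _ | _] = X i @^-1` set0); last by rewrite -tl.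
  by rewrite preimage_set0 measure0.
- have rayE (S : Type) (F : S -> R) : [set w | (t%:E < (EFin \o F) w)%E] =
      [set w | (c <= level ts (F w))%N].
    rewrite -[RHS]/(F @^-1` [set x | (c <= level ts x)%N]) tl.
    by apply/seteqP; split => w /=; rewrite in_itv/= andbT lte_fin.
  by have := XY i t; rewrite !rayE.
Qed.

(** * Order statistics and the event that the system outlives [s] *)

Lemma nth_sort_gt (R : realType) (s : seq (\bar R)) (x : \bar R) (j : nat) :
  (x < +oo)%E ->
  (x < nth +oo (sort <=%O s) j)%E = (count (<= x)%O s <= j)%N.
Proof.
move=> xoo; have ss : sorted <=%O (sort <=%O s) := sort_le_sorted s.
rewrite -(count_sort <=%O); apply/idP/idP => [|cj].
  by apply: contraTT; rewrite -ltnNge -leNgt; exact: nth_count_le.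
(* Past the end of the list the default [+oo] exceeds [x] by [xoo]; this is the convention for the
   order statistic of rank [n+1]. *)
have [js|sj] := ltnP j (size s); last by rewrite nth_default// size_sort.
by apply: nth_count_gt => //; rewrite cj size_sort.
Qed.

(** Counting replaces sorting: the number of values at most [s] is visibly nonincreasing in each
    lifetime. *)
Lemma order_stat_gt (R : realType) (T : Type) (n : nat) (W : 'I_n -> T -> R)
    (j : nat) (w : T) (s : R) :
  (s%:E < order_stat W j.+1 w)%E = (#|[pred i | (W i w <= s)%R]| <= j)%N.
Proof.
rewrite /order_stat nth_sort_gt ?ltry//= count_map cardE size_filter.
by rewrite enumT; congr (_ <= _)%N; apply: eq_count => i /=; rewrite lee_fin.
Qed.

Lemma rat_between (R : realType) (a : R) (x : \bar R) :
  (a%:E < x)%E <-> exists q : rat, a < ratr q /\ ((ratr q)%:E < x)%E.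
Proof.
split => [|[q [aq qx]]]; last by apply: lt_trans qx; rewrite lte_fin.
case: x => [x| |] //.
  rewrite lte_fin => /rat_in_itvoo[q]; rewrite in_itv/= => /andP[aq qx].
  by exists q; rewrite lte_fin.
have /rat_in_itvoo[q] : a < a + 1 by rewrite ltrDl.
by rewrite in_itv/= => /andP[aq _]; exists q; rewrite ltry.
Qed.

(** An enumeration of the rationals; an index that codes none is sent to 0, itself a rational, so no
    spurious value appears. *)
Definition nth_rat (R : realType) (j : nat) : R :=
  ratr (odflt 0 (unpickle j : option rat)).

(* With [m = n - k], the events below increase in [N] to [T > s], since
   [W_{m+1:n} + Z > s] iff [W_{m+1:n} > q] and [Z > s - q] for a rational [q]. *)
Definition standby_approx (R : realType) (n m : nat) (s : R) (N : nat)
    (v : option 'I_n -> R) : Prop :=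
  (#|[pred i | (v (Some i) <= s)%R]| <= m.+1)%N /\
  exists2 j, (j < N)%N &
    (#|[pred i | (v (Some i) <= nth_rat R j)%R]| <= m)%N /\
    s - nth_rat R j < v None.

Lemma standby_lifetime_gt (R : realType) (T : Type) (n k : nat)
    (W : 'I_n -> T -> R) (Z : T -> R) (s : R) :
  [set w | (s%:E < standby_lifetime k W Z w)%E] =
  \bigcup_N [set w | standby_approx (n - k) s N
                       (fun o => (if o is Some i then W i else Z) w)].
Proof.
have ltD w : (s%:E < order_stat W (n - k).+1 w + (Z w)%:E)%E <->
    exists q : rat, s - Z w < ratr q /\
      ((ratr q)%:E < order_stat W (n - k).+1 w)%E.
  by rewrite -rat_between EFinB lteBlDr.
apply/seteqP; split => w /=.
  (* The two ranks allow at most [n - k] and [(n - k).+1] small values; for [k = 1] the second bound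
     always holds, in accordance with the value [+oo]. *)
  rewrite /standby_lifetime addn1 addn2 lt_min order_stat_gt.
  move=> /andP[/ltD[q []]].
  rewrite order_stat_gt => Zq Wq Ws; exists (pickle q).+1 => //=; split => //.
  by exists (pickle q) => //; rewrite /nth_rat pickleK/= ltrBlDl -ltrBlDr.
move=> [N _ /= [Ws [j jN [Wq Zq]]]].
rewrite /standby_lifetime addn1 addn2 lt_min order_stat_gt Ws andbT.
apply/ltD; exists (odflt 0 (unpickle j)); rewrite order_stat_gt; split => //.
by rewrite ltrBlDr -ltrBlDl.
Qed.

(** Active components are compared with [s] and the first [N] terms of [nth_rat], the standby unit
    with [s] minus such a term. One common list serves all coordinates. *)
Definition standby_thresholds (R : realType) (s : R) (N : nat) : seq R :=
  s :: map (nth_rat R) (iota 0 N) ++ [seq s - nth_rat R j | j <- iota 0 N].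

Lemma standby_approx_up (R : realType) (n m : nat) (s : R) (N : nat)
    (u v : option 'I_n -> R) :
  (forall o t, t \in standby_thresholds s N -> t < u o -> t < v o) ->
  standby_approx m s N u -> standby_approx m s N v.
Proof.
move=> uv [us [j jN [uq uZ]]].
have card_le t : t \in standby_thresholds s N ->
    (#|[pred i : 'I_n | (v (Some i) <= t)%R]| <=
     #|[pred i : 'I_n | (u (Some i) <= t)%R]|)%N.
  move=> tts; apply: subset_leq_card; apply/fintype.subsetP => i.
  rewrite !inE !leNgt; by apply: contra; exact: uv.
have jin : j \in iota 0 N by rewrite mem_iota.
split; first by apply: leq_trans us; apply: card_le; rewrite mem_head.
exists j => //; split.
  by apply: leq_trans uq; apply: card_le; rewrite inE mem_cat map_f ?orbT.
apply: uv uZ; rewrite inE mem_cat.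
by rewrite (map_f (fun j => s - nth_rat R j) jin) !orbT.
Qed.

(** * Passage from the approximating events to the system lifetimes *)

Section standby_probability.
Context (d : measure_display) (T : measurableType d) (R : realType)
  (P : probability T R) (n k : nat) (W : 'I_n -> {RV P >-> R})
  (Z : {RV P >-> R}).
Let approx (s : R) (N : nat) : set T :=
  [set w | standby_approx (n - k) s N (fun o => with_standby W Z o w)].

Let approxE s :
  [set w | (s%:E < standby_lifetime k W Z w)%E] = \bigcup_N approx s N.
Proof.
rewrite standby_lifetime_gt; apply: eq_bigcupr => N _.
by apply/seteqP; split => w; congr standby_approx; apply/funext => -[].
Qed.

Let measurable_approx s N : measurable (approx s N).
Proof. exact: measurable_threshold_event (@standby_approx_up _ _ _ _ _). Qed.

Lemma measurable_standby_lifetime_gt s :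
  measurable [set w | (s%:E < standby_lifetime k W Z w)%E].
Proof. by rewrite approxE; exact: bigcup_measurable. Qed.

(** Continuity from below: a larger [N] only admits more rationals [q]. *)
Lemma standby_lifetime_gt_cvg s :
  P (approx s N) @[N --> \oo] -->
  P [set w | (s%:E < standby_lifetime k W Z w)%E].
Proof.
rewrite approxE; apply: nondecreasing_cvg_mu => //.
  exact: bigcup_measurable.
move=> N N' NN'; apply/subsetPset => w [Ws [j jN Wj]]; split => //.
by exists j => //; exact: leq_trans jN NN'.
Qed.

End standby_probability.

(** For [1 <= k <= n] the 0-based index [n - k] lies inside the sorted list, so the first term of
    the minimum is finite even when the second is [+oo]. *)
Lemma standby_lifetime_fin_num (R : realType) (T : Type) (n k : nat)
    (hk : (1 <= k <= n)%N) (W : 'I_n -> T -> R) (Z : T -> R) (w : T) :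
  (forall i, 0 <= W i w) -> 0 <= Z w ->
  (0 <= standby_lifetime k W Z w)%E /\
  standby_lifetime k W Z w \is a fin_num.
Proof.
move=> W0 Z0.
pose s := sort <=%O [seq (W i w)%:E | i <- enum 'I_n].
have sz : size s = n by rewrite size_sort size_map size_enum_ord.
have os j : order_stat W j w \in +oo%E :: s.
  rewrite /order_stat -/s inE; have [js|sj] := ltnP j.-1 (size s).
    by rewrite mem_nth ?orbT.
  by rewrite nth_default ?eqxx.
have in_s x : x \in s -> exists i, x = (W i w)%:E.
  by rewrite mem_sort => /mapP[i _ ->]; exists i.
have os0 j : (0 <= order_stat W j w)%E.
  by have := os j; rewrite inE => /orP[/eqP -> //|/in_s[i ->]]; rewrite lee_fin.
have T0 : (0 <= standby_lifetime k W Z w)%E.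
  by rewrite /standby_lifetime le_min os0 andbT adde_ge0 ?lee_fin.
split => //; rewrite ge0_fin_numE// /standby_lifetime gt_min; apply/orP; left.
rewrite {1}/order_stat -/s addn1 /=.
have /in_s[i ->] : nth +oo%E s (n - k) \in s.
  by rewrite mem_nth// sz ltn_subrL; case/andP: hk => k0 /(leq_trans k0) ->;
    rewrite k0.
by rewrite -EFinD ltry.
Qed.

Lemma standby_lifetime_st_le (R : realType) (n k : nat)
  (d1 : measure_display) (Omega1 : measurableType d1) (P1 : probability Omega1 R)
  (d2 : measure_display) (Omega2 : measurableType d2) (P2 : probability Omega2 R)
  (X : 'I_n -> {RV P1 >-> R}) (Z1 : {RV P1 >-> R})
  (Y : 'I_n -> {RV P2 >-> R}) (Z2 : {RV P2 >-> R})
  (indep1 : mutually_independent (with_standby X Z1))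
  (indep2 : mutually_independent (with_standby Y Z2))
  (XY : forall i, st_le P1 P2 (EFin \o X i) (EFin \o Y i))
  (ZZ : st_le P1 P2 (EFin \o Z1) (EFin \o Z2)) :
  st_le P1 P2 (standby_lifetime k X Z1) (standby_lifetime k Y Z2).
Proof.
move=> s; apply: (lee_cvg_to (@standby_lifetime_gt_cvg _ _ _ P1 n k X Z1 s)
  (@standby_lifetime_gt_cvg _ _ _ P2 n k Y Z2 s)).
apply: nearW => N; apply: threshold_event_st_le indep1 indep2 _ _.
- by case.
- exact: standby_approx_up.
Qed.

(** * From the stochastic order to expectations *)

Lemma st_le_expectation (R : realType)
    (d1 : measure_display) (T1 : measurableType d1) (P1 : probability T1 R)
    (d2 : measure_display) (T2 : measurableType d2) (P2 : probability T2 R)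
    (U : {RV P1 >-> R}) (V : {RV P2 >-> R}) :
  (forall w, 0 <= U w) -> (forall w, 0 <= V w) ->
  st_le P1 P2 (EFin \o U) (EFin \o V) ->
  ('E_P1[U] <= 'E_P2[V])%E.
Proof.
move=> U0 V0 UV; rewrite !ge0_expectation_ccdf//.
apply: ge0_le_integral => //;
    try by move=> mD B mB; apply: measurableI => //;
      rewrite -[X in measurable X]setTI; exact: ccdf_measurable.
move=> r _; have := UV r; rewrite /ccdf /distribution /pushforward.
have rayE (S : Type) (F : S -> R) :
    [set w | (r%:E < (EFin \o F) w)%E] = F @^-1` `]r, +oo[.
  by apply/seteqP; split => w /=; rewrite in_itv/= andbT lte_fin.
by rewrite !rayE.
Qed.

(** Finiteness allows replacing [U] and [V] by the real random variables [fine \o U] and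
    [fine \o V], for which the tail formula is available; measurability is checked on the open rays
    that generate the Borel sets. *)
Lemma ereal_st_le_integral (R : realType)
    (d1 : measure_display) (T1 : measurableType d1) (P1 : probability T1 R)
    (d2 : measure_display) (T2 : measurableType d2) (P2 : probability T2 R)
    (U : T1 -> \bar R) (V : T2 -> \bar R) :
  (forall s : R, measurable [set w | (s%:E < U w)%E]) ->
  (forall s : R, measurable [set w | (s%:E < V w)%E]) ->
  (forall w, (0 <= U w)%E /\ U w \is a fin_num) ->
  (forall w, (0 <= V w)%E /\ V w \is a fin_num) ->
  st_le P1 P2 U V -> (\int[P1]_w U w <= \int[P2]_w V w)%E.
Proof.
move=> mU mV U0 V0 UV.
have mfine d (T : measurableType d) (F : T -> \bar R) :
    (forall s : R, measurable [set w | (s%:E < F w)%E]) ->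
    (forall w, (0 <= F w)%E /\ F w \is a fin_num) ->
    measurable_fun setT (fine \o F).
  move=> mF F0; apply: measurability (measurable_realfun.RGenOInfty.measurableE R) _ => //.
  move=> _ [_ [r ->] <-]; rewrite setTI.
  rewrite (_ : _ @^-1` _ = [set w | (r%:E < F w)%E])//.
  apply/seteqP; split => w /=; have [_ Fw] := F0 w;
    by rewrite in_itv/= andbT -{1 2}(fineK Fw) lte_fin.
pose U' : {RV P1 >-> R} := HB.pack (fine \o U)
  (@isMeasurableFun.Build _ _ _ _ _ (mfine _ _ _ mU U0)).
pose V' : {RV P2 >-> R} := HB.pack (fine \o V)
  (@isMeasurableFun.Build _ _ _ _ _ (mfine _ _ _ mV V0)).
have UE w : (EFin \o U') w = U w by rewrite /= fineK//; case: (U0 w).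
have VE w : (EFin \o V') w = V w by rewrite /= fineK//; case: (V0 w).
rewrite -(eq_integral _ _ (fun w _ => UE w)).
rewrite -(eq_integral _ _ (fun w _ => VE w)).
have := @st_le_expectation _ _ _ _ _ _ _ U' V'; rewrite !expectation_def; apply.
- by move=> w /=; apply: fine_ge0; case: (U0 w).
- by move=> w /=; apply: fine_ge0; case: (V0 w).
- by rewrite (funext UE) (funext VE).
Qed.

Theorem theorem4p1 (R : realType) (n k : nat) (hk : (1 <= k <= n)%N)
  (d1 : measure_display) (Omega1 : measurableType d1) (P1 : probability Omega1 R)
  (d2 : measure_display) (Omega2 : measurableType d2) (P2 : probability Omega2 R)
  (X : 'I_n -> {RV P1 >-> R}) (Z1 : {RV P1 >-> R})
  (Y : 'I_n -> {RV P2 >-> R}) (Z2 : {RV P2 >-> R})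
  (X_ge0 : forall i w, 0 <= X i w) (Z1_ge0 : forall w, 0 <= Z1 w)
  (Y_ge0 : forall i w, 0 <= Y i w) (Z2_ge0 : forall w, 0 <= Z2 w)
  (indep1 : mutually_independent (with_standby X Z1))
  (indep2 : mutually_independent (with_standby Y Z2))
  (XY : forall i, st_le P1 P2 (EFin \o X i) (EFin \o Y i))
  (ZZ : st_le P1 P2 (EFin \o Z1) (EFin \o Z2)) :
  let T1 := standby_lifetime k X Z1 in
  let T2 := standby_lifetime k Y Z2 in
  st_le P1 P2 T1 T2 /\
  (\int[P1]_w T1 w <= \int[P2]_w T2 w)%E.
Proof.
move=> T1 T2; have TT : st_le P1 P2 T1 T2 by exact: standby_lifetime_st_le.
split => //; apply: ereal_st_le_integral TT => [s|s|w|w].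
- exact: measurable_standby_lifetime_gt.
- exact: measurable_standby_lifetime_gt.
- exact: standby_lifetime_fin_num.
- exact: standby_lifetime_fin_num.
Qed.
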